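(* Let $\mathcal{I}=\{X; f_{ij}, p_{ij}: 1\leq i,j\leq N\}$ be a bi-Lipschitz recurrent iterated function system and let $\mu$ be the associated Borel probability measure supported on its limit set. For each $m\geq 2$, $\mu$ satisfies the inequality (between Borel measures) $$\mu\leq \frac{1}{p_{\min}}\sum_{w\in \Omega_m}p_w\,\mu\circ f_w^{-1}.$$
   Context: Recurrent IFS. Let $X\subset\mathbb{R}^k$ be a nonempty compact set equal to the closure of its interior, with Euclidean metric $d$. Let $N\geq 2$ and let $f_{ij}:X\to X$ ($1\le i,j\le N$) satisfy $c_{ij}d(x,y)\leq d(f_{ij}(x),f_{ij}(y))\leq s_{ij}d(x,y)$ for all $x,y\in X$, where $0<c_{ij}\leq s_{ij}<1$. Let $P=[p_{ij}]_{1\le i,j\le N}$ be an irreducible row stochastic matrix ($p_{ij}\ge 0$, $\sum_{j}p_{ij}=1$ for all $i$). The collection $\mathcal{I}=\{X;f_{ij},p_{ij}:1\le i,j\le N\}$ is called a bi-Lipschitz recurrent iterated function system (RIFS). There are unique nonempty compact sets $E_1,\dots,E_N\subseteq X$ with $E_i=\bigcup_{j:\,p_{ji}>0}f_{ij}(E_j)$; the limit set is $E=\bigcup_{i=1}^N E_i$. Measure. The code space is $\Omega=\{(w_1,w_2,\ldots): 1\le w_i\le N,\ p_{w_{i+1}w_i}>0 \text{ for all } i\in\mathbb{N}\}$. Let $p=(p_1,\dots,p_N)$ be the unique probability vector with $pP=p$. Let $\nu$ be the unique Borel probability measure on $\Omega$ with $\nu([w_1,\dots,w_n])=p_{w_2w_1}p_{w_3w_2}\cdots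 p_{w_nw_{n-1}}p_{w_n}$ for every cylinder $[w_1,\dots,w_n]=\{\tau\in\Omega:\tau_i=w_i,\ 1\le i\le n\}$. The coding map $\pi:\Omega\to E$ sends $w$ to the unique point of $\bigcap_{n\ge2}f_{w_1w_2}\circ f_{w_2w_3}\circ\cdots\circ f_{w_{n-1}w_n}(E_{w_n})$. The measure associated with $\mathcal{I}$ is $\mu=\nu\circ\pi^{-1}$ (its support is $E$). Words. For $n\ge2$, $\Omega_n=\{(w_1,\dots,w_n):1\le w_i\le N,\ p_{w_{i+1}w_i}>0\text{ for }1\le i\le n-1\}$. For $w=(w_1,\dots,w_n)\in\Omega_n$, $f_w=f_{w_1w_2}\circ f_{w_2w_3}\circ\cdots\circ f_{w_{n-1}w_n}$ and $p_w=p_{w_2w_1}p_{w_3w_2}\cdots p_{w_nw_{n-1}}p_{w_n}$. Also $p_{\min}=\min\{p_1,\dots,p_N\}$. Here $\mu\circ f_w^{-1}(A)=\mu(\{x\in X:f_w(x)\in A\})$ for Borel $A\subseteq\mathbb{R}^k$. *)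

(* Defs.v *)
From HB Require Import structures.
From mathcomp Require Import all_boot all_order all_algebra.
From mathcomp Require Import all_classical all_reals all_analysis.
Import Order.TTheory GRing.Theory Num.Theory.
Import numFieldNormedType.Exports.

Set Implicit Arguments.
Unset Strict Implicit.
Unset Printing Implicit Defensive.

Local Open Scope classical_set_scope.
Local Open Scope ring_scope.

(* The norm that the library puts on ['rV[R]_k] is the sup norm; it induces the
   same topology as the Euclidean metric but not the same Lipschitz constants. *)
Definition edist (R : realType) (k : nat) (x y : 'rV[R]_k) : R :=
  Num.sqrt (\sum_(i < k) (x ord0 i - y ord0 i) ^+ 2).

Definition bilipschitz_on (R : realType) (k : nat) (X : set 'rV[R]_k)
    (c s : R) (g : 'rV[R]_k -> 'rV[R]_k) : Prop :=
  forall x y, X x -> X y ->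
    c * edist x y <= edist (g x) (g y) /\ edist (g x) (g y) <= s * edist x y.

Definition row_stochastic (R : realType) (N : nat) (P : 'M[R]_N) : Prop :=
  (forall i j, 0 <= P i j) /\ (forall i, \sum_(j < N) P i j = 1).

Definition irreducible_mx (R : realType) (N : nat) (P : 'M[R]_N) : Prop :=
  forall i j, exists2 n : nat, (0 < n)%N & 0 < (P ^+ n) i j.

(* The maps [f_ij : X -> X] are represented by total functions on ['rV[R]_k]
   of which only the values on [X] matter. *)
Record rifs (R : realType) (k N : nat) := Rifs {
  rifs_X : set 'rV[R]_k;
  rifs_f : 'I_N -> 'I_N -> 'rV[R]_k -> 'rV[R]_k;
  rifs_P : 'M[R]_N;
  rifs_N : (2 <= N)%N;
  rifs_X_neq0 : rifs_X !=set0;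
  rifs_X_compact : compact rifs_X;
  rifs_X_closure : closure (rifs_X)° = rifs_X;
  rifs_f_X : forall i j x, rifs_X x -> rifs_X (rifs_f i j x);
  rifs_f_lip : forall i j, exists c s : R,
    [/\ 0 < c, c <= s, s < 1 & bilipschitz_on rifs_X c s (rifs_f i j)];
  rifs_P_stoch : row_stochastic rifs_P;
  rifs_P_irr : irreducible_mx rifs_P }.

Definition is_limit_family (R : realType) (k N : nat) (I : rifs R k N)
    (E : 'I_N -> set 'rV[R]_k) : Prop :=
  forall i, [/\ E i !=set0, compact (E i), E i `<=` rifs_X I &
    E i = \bigcup_(j in [set j | 0 < rifs_P I j i]) (rifs_f I i j @` E j)].

(* Sequences are indexed from 0: the letter [w_n] of the text is [w n.-1]. *)
Definition code_set (R : realType) (k N : nat) (I : rifs R k N) :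
    set {ptws nat -> discrete_topology 'I_N} :=
  [set w | forall n, 0 < rifs_P I (w n.+1) (w n)].

(* A subspace of the product of discrete spaces. *)
Definition code_space (R : realType) (k N : nat) (I : rifs R k N) : Type :=
  set_type (code_set I).

HB.instance Definition _ (R : realType) (k N : nat) (I : rifs R k N) :=
  Topological.copy (code_space I) (set_type (code_set I)).

(* The library's measurable types are pointed, so a code is needed; it is built
   from the fact that every column of [P] has a positive entry. *)
Lemma rifs_P_pred (R : realType) (k N : nat) (I : rifs R k N) (i : 'I_N) :
  exists j : 'I_N, 0 < rifs_P I j i.
Proof.
have [n n0] := rifs_P_irr I i i.
case: n n0 => // n _; rewrite exprSr mxE => h.
have : exists j : 'I_N, rifs_P I j i != 0.
  apply/existsP; apply: contraTT h => /existsPn h.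
  rewrite big1 ?ltxx// => j _.
  by have /negPn/eqP -> := h j; rewrite mulr0.
by move=> [j Pj]; exists j; rewrite lt0r Pj (rifs_P_stoch I).1.
Qed.

Lemma code_set_neq0 (R : realType) (k N : nat) (I : rifs R k N) :
  code_set I !=set0.
Proof.
have N0 : (0 < N)%N by exact: leq_trans (rifs_N I).
exists (fun n => iter n (fun i => sval (cid (rifs_P_pred I i))) (Ordinal N0)).
by move=> n /=; case: cid.
Qed.

HB.instance Definition _ (R : realType) (k N : nat) (I : rifs R k N) :=
  isPointed.Build (code_space I)
    (exist _ (sval (cid (code_set_neq0 I)))
             (mem_set (svalP (cid (code_set_neq0 I))))).

(* The measurable types whose measurable sets are the Borel sets. *)
Definition borel_code (R : realType) (k N : nat) (I : rifs R k N) :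
    measurableType (sigma_display (@open (code_space I))) :=
  g_sigma_algebraType (@open (code_space I)).

Definition borel_rV (R : realType) (k : nat) :
    measurableType (sigma_display (@open 'rV[R]_k)) :=
  g_sigma_algebraType (@open 'rV[R]_k).

Definition stationary (R : realType) (k N : nat) (I : rifs R k N)
    (p : 'rV[R]_N) : Prop :=
  [/\ forall i, 0 <= p ord0 i, \sum_(i < N) p ord0 i = 1 & p *m rifs_P I = p].

(* The entries of a probability vector are at most 1, so the neutral element 1
   does not affect the minimum. *)
Definition pmin (R : realType) (N : nat) (p : 'rV[R]_N) : R :=
  \big[Order.min/1]_(i < N) p ord0 i.

Definition words (R : realType) (k N : nat) (I : rifs R k N) (n : nat) :
    {set n.-tuple 'I_N} :=
  [set w : n.-tuple 'I_N | sorted (fun i j => 0 < rifs_P I j i) w].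

Fixpoint fword (R : realType) (k N : nat) (I : rifs R k N) (w : seq 'I_N) :
    'rV[R]_k -> 'rV[R]_k :=
  match w with
  | i :: ((j :: _) as w') => rifs_f I i j \o fword I w'
  | _ => id
  end.

Fixpoint pword (R : realType) (k N : nat) (I : rifs R k N) (p : 'rV[R]_N)
    (w : seq 'I_N) : R :=
  match w with
  | i :: ((j :: _) as w') => rifs_P I j i * pword I p w'
  | [:: i] => p ord0 i
  | [::] => 1
  end.

Definition code_prefix (R : realType) (k N : nat) (I : rifs R k N)
    (t : code_space I) (n : nat) : seq 'I_N :=
  mkseq (set_val t : nat -> 'I_N) n.

Definition cylinder (R : realType) (k N : nat) (I : rifs R k N)
    (w : seq 'I_N) : set (code_space I) :=
  [set t | code_prefix t (size w) = w].
Arguments cylinder {R k N} I w.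

(* If [w] is not admissible both sides of the equation are 0. *)
Definition is_code_measure (R : realType) (k N : nat) (I : rifs R k N)
    (p : 'rV[R]_N) (nu : probability (borel_code I) R) : Prop :=
  forall w : seq 'I_N, w != [::] -> nu (cylinder I w) = (pword I p w)%:E.
Arguments is_code_measure {R k N} I p nu.

(* [get] selects the unique point of the intersection. *)
Definition coding (R : realType) (k N : nat) (I : rifs R k N)
    (E : 'I_N -> set 'rV[R]_k) (t : borel_code I) : borel_rV R k :=
  get (\bigcap_(n in [set n | (2 <= n)%N])
         (fword I (code_prefix t n) @`
            E ((set_val (t : code_space I) : nat -> 'I_N) n.-1))).

Definition rifs_measure (R : realType) (k N : nat) (I : rifs R k N)
    (E : 'I_N -> set 'rV[R]_k) (nu : probability (borel_code I) R) :
    set (borel_rV R k) -> \bar R :=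
  pushforward nu (coding E).
Arguments rifs_measure {R k N} I E nu.

(* Main.v *)
From HB Require Import structures.
From mathcomp Require Import all_boot all_order all_algebra.
From mathcomp Require Import all_classical all_reals all_analysis.
Require Import Defs.
Import Order.TTheory GRing.Theory Num.Theory.
Import numFieldNormedType.Exports.

(** Cut the code space into the cylinders of the admissible words [w] of length
    [m]. On the cylinder of [w = w_1 ... w_m] the coding map satisfies
    [pi (t) = f_w (pi (s t))], where [s] drops the first [m - 1] letters
    ([coding_iter_code_shift]), so the part of [pi^-1 (A)] in this cylinder
    consists of the codes [t] in it with [s t] in [(f_w o pi)^-1 (A)].

    Under [nu] the letters form a Markov chain: given the letter [w_m] at place
    [m], the letters before it are independent of those after it. By
    [code_measure_shift], the [nu]-measure of that part is
    [(p_w / p_(w_m)) * nu ([w_m] n (f_w o pi)^-1 (A))], where [n] denotes the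
    intersection. That identity holds on cylinders, which generate the Borel
    sets ([borel_code_cylinders]), and extends by uniqueness of measures.

    Forgetting the restriction to [[w_m]] and bounding [p_(w_m)] below by the
    minimum of the stationary vector, which is positive by irreducibility
    ([stationary_gt0]), gives at most [(p_w / p_min) * mu (f_w^-1 (A))]; summing
    over [w] gives the inequality.

    The sets must be measurable for this, which holds because each [f_w o pi] is
    continuous ([fword_coding_continuous]). That, and the fact that a code
    determines exactly one point, rest on the nested compact sets
    [f_(t_1 ... t_n) (E_(t_n))], whose diameters decrease to 0 uniformly in
    the code ([coding_piece_diameter]). *)

Set Implicit Arguments.
Unset Strict Implicit.
Unset Printing Implicit Defensive.

Local Open Scope classical_set_scope.
Local Open Scope ring_scope.

(** * Euclidean distance and contraction *)

Lemma euclid_ge0 (R : realType) (k : nat) (x y : 'rV[R]_k) : 0 <= edist x y.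
Proof. exact: sqrtr_ge0. Qed.

(** The topology and the compactness theory of row vectors are phrased with the
    sup norm, while the maps contract the Euclidean distance: this comparison
    and [euclid_le_normrB] carry statements from one to the other. *)
Lemma normrB_le_euclid (R : realType) (k : nat) (x y : 'rV[R]_k) :
  `|x - y| <= edist x y.
Proof.
rewrite [leLHS]/Num.norm /= mx_normrE; apply/bigmax_leP; split => [|[i j] _ /=].
  exact: euclid_ge0.
rewrite !mxE ord1 -sqrtr_sqr ler_sqrt; last first.
  by apply: sumr_ge0 => *; exact: sqr_ge0.
by rewrite (bigD1 j)//= lerDl; apply: sumr_ge0 => *; exact: sqr_ge0.
Qed.

Lemma euclid_le_normrB (R : realType) (k : nat) (x y : 'rV[R]_k) :
  edist x y <= k.+1%:R * `|x - y|.
Proof.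
rewrite -(ger0_norm (mulr_ge0 (ler0n R k.+1) (normr_ge0 (x - y)))) -sqrtr_sqr.
rewrite ler_sqrt ?sqr_ge0// exprMn.
apply: (@le_trans _ _ (\sum_(i < k) `|x - y| ^+ 2)).
  apply: ler_sum => i _; rewrite -real_normK ?num_real// ler_sqr ?nnegrE//.
  rewrite [leRHS]/Num.norm /= mx_normrE; apply/bigmax_geP; right => /=.
  by exists (ord0, i) => //=; rewrite !mxE.
rewrite sumr_const card_ord -[leLHS]mulr_natl ler_wpM2r ?sqr_ge0//.
by rewrite -natrX ler_nat (leq_trans (leqnSn k))// leq_pmulr.
Qed.

Lemma euclid_le0_eq (R : realType) (k : nat) (x y : 'rV[R]_k) :
  edist x y <= 0 -> x = y.
Proof.
move=> xy0; apply/eqP; rewrite -subr_eq0 -normr_le0.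
exact: le_trans (normrB_le_euclid x y) xy0.
Qed.

Lemma compact_euclid_bounded (R : realType) (k : nat) (X : set 'rV[R]_k) :
  compact X -> exists2 D : R, 0 <= D & forall x y, X x -> X y -> edist x y <= D.
Proof.
move=> /compact_bounded[M [Mr XM]].
pose B := `|M| + 1.
have XB x : X x -> `|x| <= B.
  by move=> Xx; apply: XM => //; rewrite /B (le_lt_trans (ler_norm M))// ltrDl.
exists (k.+1%:R * (B + B)).
  by rewrite mulr_ge0// !addr_ge0.
move=> x y Xx Xy; apply: le_trans (euclid_le_normrB x y) _.
rewrite ler_wpM2l//; apply: le_trans (ler_normB x y) _.
by rewrite lerD// XB.
Qed.

(** There are finitely many maps, so the largest of their Lipschitz constants is
    still below 1. *)
Lemma rifs_contraction (R : realType) (k N : nat) (I : rifs R k N) :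
  exists s : R, [/\ 0 <= s, s < 1 &
    forall i j x y, rifs_X I x -> rifs_X I y ->
      edist (rifs_f I i j x) (rifs_f I i j y) <= s * edist x y].
Proof.
have /choice[s_ sP] (ij : 'I_N * 'I_N) : exists s : R, s < 1 /\
    forall x y, rifs_X I x -> rifs_X I y ->
      edist (rifs_f I ij.1 ij.2 x) (rifs_f I ij.1 ij.2 y) <= s * edist x y.
  have [c [s [_ _ s1 fP]]] := rifs_f_lip I ij.1 ij.2.
  by exists s; split => // x y Xx Xy; have [] := fP _ _ Xx Xy.
exists (\big[Order.max/0]_ij s_ ij); split.
- exact: bigmax_ge_id.
- by apply/bigmax_ltP; split => // ij _; exact: (sP ij).1.
- move=> i j x y Xx Xy; apply: le_trans ((sP (i, j)).2 x y Xx Xy) _.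
  by rewrite ler_wpM2r ?euclid_ge0// (le_bigmax _ s_ (i, j)).
Qed.

Lemma rifs_f_continuous (R : realType) (k N : nat) (I : rifs R k N) i j :
  {within rifs_X I, continuous (rifs_f I i j)}.
Proof.
apply/subspace_continuousP => x Xx; have [s [s0 s1 fs]] := rifs_contraction I.
apply/cvgrPdist_lt => e e0; rewrite near_withinE.
have k0 : 0 < k.+1%:R :> R by [].
have : \forall y \near x, `|x - y| < e / k.+1%:R.
  have /cvgrPdist_lt := @cvg_id _ (nbhs x).
  by apply; rewrite divr_gt0.
apply: filterS => y xy Xy.
apply: le_lt_trans (normrB_le_euclid _ _) _.
apply: le_lt_trans (fs i j _ _ Xx Xy) _.
apply: (@le_lt_trans _ _ (edist x y)).
  by rewrite ler_piMl ?euclid_ge0// ltW.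
apply: le_lt_trans (euclid_le_normrB _ _) _.
by rewrite mulrC -ltr_pdivlMr.
Qed.

Lemma fword_X (R : realType) (k N : nat) (I : rifs R k N) (w : seq 'I_N) x :
  rifs_X I x -> rifs_X I (fword I w x).
Proof.
elim: w => [//|i [|j w] IH] Xx //.
by apply: rifs_f_X; exact: IH.
Qed.

Lemma fword_contraction (R : realType) (k N : nat) (I : rifs R k N) (s : R) :
    0 <= s ->
    (forall i j x y, rifs_X I x -> rifs_X I y ->
      edist (rifs_f I i j x) (rifs_f I i j y) <= s * edist x y) ->
  forall (w : seq 'I_N) x y, rifs_X I x -> rifs_X I y ->
    edist (fword I w x) (fword I w y) <= s ^+ (size w).-1 * edist x y.
Proof.
move=> s0 fs; elim=> [|i [|j w] IH] x y Xx Xy; rewrite ?expr0 ?mul1r//=.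
apply: le_trans (fs _ _ _ _ (fword_X (j :: w) Xx) (fword_X (j :: w) Xy)) _.
by rewrite exprS -mulrA ler_wpM2l//; exact: IH.
Qed.

(** * Codes and the shift *)

Definition letter (R : realType) (k N : nat) (I : rifs R k N)
  (t : code_space I) (n : nat) : 'I_N := (set_val t : nat -> 'I_N) n.

Lemma letterP (R : realType) (k N : nat) (I : rifs R k N)
  (t : code_space I) (n : nat) : 0 < rifs_P I (letter t n.+1) (letter t n).
Proof. exact: (set_mem (valP t)). Qed.

Lemma code_shift_subproof (R : realType) (k N : nat) (I : rifs R k N)
  (t : code_space I) : code_set I (fun n => letter t n.+1).
Proof. by move=> n; exact: letterP. Qed.

Definition code_shift (R : realType) (k N : nat) (I : rifs R k N)
  (t : code_space I) : code_space I :=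
  exist _ (fun n => letter t n.+1) (mem_set (code_shift_subproof t)).

Lemma letter_code_shift (R : realType) (k N : nat) (I : rifs R k N)
  (t : code_space I) (n : nat) : letter (code_shift t) n = letter t n.+1.
Proof. by rewrite /letter set_valE. Qed.

Lemma letter_iter_code_shift (R : realType) (k N : nat) (I : rifs R k N) m
    (t : code_space I) (n : nat) :
  letter (iter m (@code_shift R k N I) t) n = letter t (m + n).
Proof.
by elim: m n => [//|m IH] n; rewrite iterS letter_code_shift IH addnS.
Qed.

Lemma code_prefixE (R : realType) (k N : nat) (I : rifs R k N)
  (t : code_space I) (n : nat) : code_prefix t n = mkseq (letter t) n.
Proof. by []. Qed.

Lemma size_code_prefix (R : realType) (k N : nat) (I : rifs R k N)
  (t : code_space I) (n : nat) : size (code_prefix t n) = n.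
Proof. exact: size_mkseq. Qed.

Lemma code_prefixD (R : realType) (k N : nat) (I : rifs R k N)
    (t : code_space I) (m n : nat) :
  code_prefix t (m + n) =
  code_prefix t m ++ code_prefix (iter m (@code_shift R k N I) t) n.
Proof.
rewrite !code_prefixE /mkseq iotaD map_cat add0n; congr (_ ++ _).
rewrite -[X in iota X _]addn0 iotaDl -map_comp; apply: eq_map => i /=.
by rewrite letter_iter_code_shift.
Qed.

Lemma code_prefixS (R : realType) (k N : nat) (I : rifs R k N)
    (t : code_space I) (n : nat) :
  code_prefix t n.+1 = letter t 0 :: code_prefix (code_shift t) n.
Proof. by rewrite -add1n code_prefixD. Qed.

(** * The coding map *)

Definition coding_piece (R : realType) (k N : nat) (I : rifs R k N)
    (E : 'I_N -> set 'rV[R]_k) (t : code_space I) (n : nat) : set 'rV[R]_k :=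
  fword I (code_prefix t n.+1) @` E (letter t n).

Lemma coding_piece0 (R : realType) (k N : nat) (I : rifs R k N)
    (E : 'I_N -> set 'rV[R]_k) (t : code_space I) :
  coding_piece E t 0 = E (letter t 0).
Proof. by rewrite /coding_piece /= image_id. Qed.

(** The pieces of a code are the images, under one map, of the pieces of the
    shifted code, so properties of the pieces can be proved by induction on the
    depth, for all codes at once. *)
Lemma coding_pieceS (R : realType) (k N : nat) (I : rifs R k N)
    (E : 'I_N -> set 'rV[R]_k) (t : code_space I) (n : nat) :
  coding_piece E t n.+1 =
  rifs_f I (letter t 0) (letter t 1) @` coding_piece E (code_shift t) n.
Proof.
rewrite /coding_piece letter_code_shift (code_prefixS t).
by rewrite (code_prefixS (code_shift t)) letter_code_shift image_comp.
Qed.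

(** If [j] may follow [i] in a code, then [f_ij (E_j)] is one of the sets whose
    union is [E_i]. *)
Lemma coding_piece_decreasing (R : realType) (k N : nat) (I : rifs R k N)
    (E : 'I_N -> set 'rV[R]_k) (hE : is_limit_family I E)
    (t : code_space I) (n : nat) :
  coding_piece E t n.+1 `<=` coding_piece E t n.
Proof.
elim: n t => [|n IH] t.
  rewrite coding_pieceS !coding_piece0 letter_code_shift.
  have [_ _ _ ->] := hE (letter t 0); move=> _ [x Ex <-].
  by exists (letter t 1); [exact: letterP|exact: imageP].
rewrite coding_pieceS [X in _ `<=` X]coding_pieceS.
by apply: image_subset; exact: IH.
Qed.

Lemma coding_piece_antitone (R : realType) (k N : nat) (I : rifs R k N)
    (E : 'I_N -> set 'rV[R]_k) (hE : is_limit_family I E)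
    (t : code_space I) (m n : nat) :
  (m <= n)%N -> coding_piece E t n `<=` coding_piece E t m.
Proof.
elim: n => [|n IH]; first by rewrite leqn0 => /eqP ->.
rewrite leq_eqVlt ltnS => /predU1P[->//|/IH]; apply: subset_trans.
exact: coding_piece_decreasing.
Qed.

Lemma coding_piece_X (R : realType) (k N : nat) (I : rifs R k N)
    (E : 'I_N -> set 'rV[R]_k) (hE : is_limit_family I E)
    (t : code_space I) (n : nat) :
  coding_piece E t n `<=` rifs_X I.
Proof.
move=> x /(coding_piece_antitone hE (leq0n n)); rewrite coding_piece0.
by have [_ _ + _] := hE (letter t 0); apply.
Qed.

Lemma coding_piece_neq0 (R : realType) (k N : nat) (I : rifs R k N)
    (E : 'I_N -> set 'rV[R]_k) (hE : is_limit_family I E)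
    (t : code_space I) (n : nat) : coding_piece E t n !=set0.
Proof. by apply: image_nonempty; have [] := hE (letter t n). Qed.

Lemma coding_piece_compact (R : realType) (k N : nat) (I : rifs R k N)
    (E : 'I_N -> set 'rV[R]_k) (hE : is_limit_family I E)
    (t : code_space I) (n : nat) : compact (coding_piece E t n).
Proof.
elim: n t => [|n IH] t.
  by rewrite coding_piece0; have [] := hE (letter t 0).
rewrite coding_pieceS; apply: continuous_compact (IH _).
apply: (continuous_subspaceW _ (@rifs_f_continuous _ _ _ I _ _)).
exact: coding_piece_X.
Qed.

(** The bound is uniform in the code; this uniformity is what makes the coding
    map continuous. *)
Lemma coding_piece_diameter (R : realType) (k N : nat) (I : rifs R k N)
    (E : 'I_N -> set 'rV[R]_k) (hE : is_limit_family I E) (e : R) :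
  0 < e -> exists n, forall (t : code_space I) x y,
    coding_piece E t n x -> coding_piece E t n y -> edist x y < e.
Proof.
move=> e0; have [s [s0 s1 fs]] := rifs_contraction I.
have [D D0 XD] := compact_euclid_bounded (@rifs_X_compact _ _ _ I).
have : (fun n => D * s ^+ n) @ \oo --> 0.
  rewrite -[X in _ --> X](mulr0 D); apply: cvgMr.
  by apply: cvg_expr; rewrite ger0_norm.
move=> /cvgrPdist_lt /(_ _ e0)[n _ /(_ n (leqnn n))].
rewrite /= sub0r normrN ger0_norm ?mulr_ge0 ?exprn_ge0// => Dse.
exists n => t _ _ [x Ex <-] [y Ey <-].
have EX z : E (letter t n) z -> rifs_X I z.
  by have [_ _ + _] := hE (letter t n); apply.
apply: le_lt_trans (fword_contraction s0 fs _ (EX _ Ex) (EX _ Ey)) _.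
apply: le_lt_trans Dse; rewrite size_code_prefix mulrC ler_wpM2r ?exprn_ge0//.
by apply: XD; exact: EX.
Qed.

Lemma bigcap_coding_piece_eq (R : realType) (k N : nat) (I : rifs R k N)
    (E : 'I_N -> set 'rV[R]_k) (hE : is_limit_family I E) (t : code_space I)
    (x y : 'rV[R]_k) :
  (forall n, coding_piece E t n x) -> (forall n, coding_piece E t n y) -> x = y.
Proof.
move=> tx ty; apply: euclid_le0_eq; rewrite leNgt; apply/negP => xy0.
have [n /(_ t x y (tx n) (ty n))] := coding_piece_diameter hE xy0.
by rewrite ltxx.
Qed.

(** The pieces generate a filter that contains a compact set; a cluster point of
    it lies in the closure of every piece, and the pieces are closed. *)
Lemma bigcap_coding_piece_neq0 (R : realType) (k N : nat) (I : rifs R k N)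
    (E : 'I_N -> set 'rV[R]_k) (hE : is_limit_family I E) (t : code_space I) :
  exists x, forall n, coding_piece E t n x.
Proof.
have F : ProperFilter (filter_from setT (coding_piece E t)).
  apply: filter_from_proper; last by move=> n _; exact: coding_piece_neq0.
  apply: filter_from_filter; first by exists 0%N.
  move=> m n _ _; exists (maxn m n) => //; rewrite subsetI.
  by split; apply: coding_piece_antitone; rewrite ?leq_maxl ?leq_maxr.
have [x [_ xF]] := @coding_piece_compact _ _ _ _ _ hE t 0 _ F
  (ex_intro2 _ _ 0%N Logic.I (@subset_refl _ _)).
exists x => n.
have /closure_id -> : closed (coding_piece E t n).
  by apply: compact_closed; [exact: norm_hausdorff|exact: coding_piece_compact].
by move=> B /xF; apply; exists n.
Qed.

Lemma codingP (R : realType) (k N : nat) (I : rifs R k N)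
    (E : 'I_N -> set 'rV[R]_k) (hE : is_limit_family I E) (t : code_space I)
    (n : nat) :
  coding_piece E t n (coding E t).
Proof.
have Ebig : (\bigcap_(n in [set n | (2 <= n)%N])
         (fword I (code_prefix t n) @`
            E ((set_val t : nat -> 'I_N) n.-1))) (coding E t).
  apply: (@getPex _ (\bigcap_(n in [set n | (2 <= n)%N])
         (fword I (code_prefix t n) @`
            E ((set_val t : nat -> 'I_N) n.-1)))).
  have [x xP] := bigcap_coding_piece_neq0 hE t.
  by exists x => -[//|m _]; exact: xP.
by apply: (coding_piece_antitone hE (leqnSn n)); exact: (Ebig n.+2).
Qed.

Lemma coding_uniq (R : realType) (k N : nat) (I : rifs R k N)
    (E : 'I_N -> set 'rV[R]_k) (hE : is_limit_family I E) (t : code_space I) x :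
  (forall n, coding_piece E t n x) -> coding E t = x.
Proof.
by move=> tx; apply: (bigcap_coding_piece_eq hE _ tx); exact: codingP.
Qed.

Lemma coding_X (R : realType) (k N : nat) (I : rifs R k N)
    (E : 'I_N -> set 'rV[R]_k) (hE : is_limit_family I E) (t : code_space I) :
  rifs_X I (coding E t).
Proof. exact: (coding_piece_X hE (codingP hE t 0)). Qed.

(** The right-hand side lies in every piece of [t] by [coding_pieceS], and only
    one point does. *)
Lemma coding_code_shift (R : realType) (k N : nat) (I : rifs R k N)
    (E : 'I_N -> set 'rV[R]_k) (hE : is_limit_family I E) (t : code_space I) :
  coding E t = rifs_f I (letter t 0) (letter t 1) (coding E (code_shift t)).
Proof.
apply: coding_uniq => // n; apply: (coding_piece_decreasing hE).
by rewrite coding_pieceS; apply: imageP; exact: codingP.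
Qed.

Lemma coding_iter_code_shift (R : realType) (k N : nat) (I : rifs R k N)
    (E : 'I_N -> set 'rV[R]_k) (hE : is_limit_family I E) (m : nat)
    (t : code_space I) :
  coding E t =
  fword I (code_prefix t m.+1) (coding E (iter m (@code_shift R k N I) t)).
Proof.
elim: m t => [//|m IH] t.
rewrite coding_code_shift// (IH (code_shift t)) iterSr.
by rewrite (code_prefixS t) (code_prefixS (code_shift t)) letter_code_shift.
Qed.

(** * Topology of the code space *)

Lemma cylinderE (R : realType) (k N : nat) (I : rifs R k N) (w : seq 'I_N)
  (t : code_space I) : cylinder I w t = (code_prefix t (size w) = w).
Proof. by []. Qed.

(** The filter of the cylinders around a code converges to it in the product
    topology, because each coordinate is eventually constant along this filter;
    hence that filter is finer than the neighbourhood filter. *)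
Lemma nbhs_cylinder (R : realType) (k N : nat) (I : rifs R k N)
    (t : code_space I) (U : set (code_space I)) :
  nbhs t U -> exists n, cylinder I (code_prefix t n) `<=` U.
Proof.
move=> [_ [[V oV <-] /= Vt VU]].
pose F : set_system {ptws nat -> discrete_topology 'I_N} :=
  filter_from setT (fun n => [set u | forall i, (i < n)%N -> u i = letter t i]).
have FF : Filter F.
  apply: filter_from_filter; first by exists 0%N.
  move=> m n _ _; exists (maxn m n) => // u um; split => i im; apply: um.
    by rewrite leq_max im.
  by rewrite leq_max im orbT.
have /(_ V) : F --> (set_val t : {ptws nat -> discrete_topology 'I_N}).
  apply/cvg_sup => i W [_ [[W' _ <-] /= W't WW]].
  exists i.+1 => // u /(_ i (ltnSn i)) ui; apply: WW => /=.
  by rewrite /proj ui.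
move=> /(_ (open_nbhs_nbhs (conj oV Vt)))[n _ nV].
exists n => u; rewrite cylinderE size_code_prefix => un.
apply: VU => /=; apply: nV => i /= i_n.
have := congr1 (fun s => nth (letter t 0) s i) un.
by rewrite !nth_mkseq.
Qed.

Lemma open_letter (R : realType) (k N : nat) (I : rifs R k N) n (i : 'I_N) :
  open [set t : code_space I | letter t n = i].
Proof.
exists [set u : {ptws nat -> discrete_topology 'I_N} | u n = i] => //.
rewrite openE => u /= un.
have /cvg_sup/(_ n) h : nbhs u --> u by exact: cvg_id.
apply: h; exists [set u | u n = i] => //; split => //.
by exists [set i] => //; exact: discrete_open.
Qed.

Lemma open_cylinder (R : realType) (k N : nat) (I : rifs R k N) (w : seq 'I_N) :
  open (cylinder I w).
Proof.
elim/last_ind: w => [|w i IH].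
  by rewrite (_ : cylinder I [::] = setT) ?eqEsubset//; exact: openT.
rewrite (_ : cylinder I (rcons w i) =
  cylinder I w `&` [set t : code_space I | letter t (size w) = i]).
  by apply: openI => //; exact: open_letter.
apply/seteqP; split => t; rewrite cylinderE size_rcons code_prefixE mkseqS.
  by move=> /rcons_inj[].
by move=> [wt <-]; congr rcons.
Qed.

(** The maps [f_w] are controlled only on [X], so the Borel measurability of
    [f_w^-1 (A)] is read off on the code space, where [f_w] composed with the
    coding map is continuous everywhere. The empty word gives the coding map. *)
Lemma fword_coding_continuous (R : realType) (k N : nat) (I : rifs R k N)
    (E : 'I_N -> set 'rV[R]_k) (hE : is_limit_family I E) (w : seq 'I_N) :
  continuous (fun t : code_space I => fword I w (coding E t) : 'rV[R]_k).
Proof.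
move=> t; apply/(@cvgrPdist_lt _ _ _ _ (nbhs_filter t)) => e e0.
have [s [s0 s1 fs]] := rifs_contraction I.
have [n nP] := coding_piece_diameter hE e0.
have : nbhs t (cylinder I (code_prefix t n.+1)).
  apply: open_nbhs_nbhs; split; first exact: open_cylinder.
  by rewrite cylinderE size_code_prefix.
apply: filterS => u; rewrite cylinderE size_code_prefix => tu.
apply: le_lt_trans (normrB_le_euclid _ _) _.
have tX : rifs_X I (coding E t) by exact: coding_X.
have uX : rifs_X I (coding E u) by exact: coding_X.
apply: le_lt_trans (fword_contraction s0 fs _ tX uX) _.
apply: (@le_lt_trans _ _ (edist (coding E t : 'rV_k) (coding E u))).
  by rewrite ler_piMl ?euclid_ge0// exprn_ile1// ltW.
apply: (nP t); first exact: codingP.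
have := codingP hE u n; rewrite /coding_piece tu.
suff -> : letter u n = letter t n by [].
have := congr1 (fun s => nth (letter t 0) s n) tu.
by rewrite !nth_mkseq.
Qed.

Lemma iter_code_shift_continuous (R : realType) (k N : nat) (I : rifs R k N) m :
  continuous (iter m (@code_shift R k N I)).
Proof.
move=> t U /nbhs_cylinder[n nU].
have : nbhs t (cylinder I (code_prefix t (m + n))).
  apply: open_nbhs_nbhs; split; first exact: open_cylinder.
  by rewrite cylinderE size_code_prefix.
apply: filterS => u; rewrite cylinderE size_code_prefix => tu.
apply: nU; rewrite cylinderE size_code_prefix.
move: tu; rewrite !code_prefixD => /eqP; rewrite eqseq_cat ?size_code_prefix//.
by move=> /andP[_ /eqP].
Qed.

(** * The shift and the measure of cylinders *)

Lemma continuous_borel_measurable (S T : ptopologicalType) (f : S -> T) :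
  continuous f ->
  measurable_fun setT (f : g_sigma_algebraType (@open S) ->
                           g_sigma_algebraType (@open T)).
Proof.
move=> /continuousP cf; apply: (@measurability _ _
  (g_sigma_algebraType (@open S)) (g_sigma_algebraType (@open T))
  setT f (@open T)) => //.
by move=> _ [B oB <-]; rewrite setTI; apply: sub_sigma_algebra; exact: cf.
Qed.

Lemma cylinder_cat (R : realType) (k N : nat) (I : rifs R k N)
    (u v : seq 'I_N) :
  cylinder I (u ++ v) =
  cylinder I u `&` iter (size u) (@code_shift R k N I) @^-1` cylinder I v.
Proof.
apply/seteqP; split => t; rewrite /setI/= !cylinderE size_cat code_prefixD.
  by move/eqP; rewrite eqseq_cat ?size_code_prefix// => /andP[/eqP-> /eqP->].
by move=> [-> ->].
Qed.

Lemma cylinderI (R : realType) (k N : nat) (I : rifs R k N) (v w : seq 'I_N) :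
  (size v <= size w)%N ->
  cylinder I v `&` cylinder I w =
  if take (size v) w == v then cylinder I w else set0.
Proof.
move=> vw.
have prefixE (t : code_space I) : cylinder I w t ->
    code_prefix t (size v) = take (size v) w.
  rewrite cylinderE -{1}(subnKC vw) code_prefixD => <-.
  by rewrite take_size_cat ?size_code_prefix.
case: eqP => wv; apply/seteqP; split => t.
- by case.
- by move=> wt; split=> //; rewrite cylinderE prefixE.
- by move=> [vt /prefixE]; move: vt; rewrite cylinderE => -> /esym.
- by [].
Qed.

(** The empty set is added to make this family closed under intersection. *)
Definition cylinders (R : realType) (k N : nat) (I : rifs R k N) :
    set (set (code_space I)) :=
  [set B | B = set0 \/ exists w, B = cylinder I w].

Lemma setI_closed_cylinders (R : realType) (k N : nat) (I : rifs R k N) :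
  setI_closed (@cylinders R k N I).
Proof.
move=> A B [->|[v ->]]; first by rewrite set0I; left.
move=> [->|[w ->]]; first by rewrite setI0; left.
wlog vw : v w / (size v <= size w)%N.
  have [vw|/ltnW wv] := leqP (size v) (size w); first exact.
  by rewrite setIC; exact.
by rewrite cylinderI//; case: ifP => _; [right; exists w|left].
Qed.

Lemma measurable_cylinder (R : realType) (k N : nat) (I : rifs R k N)
  (w : seq 'I_N) : measurable (cylinder I w : set (borel_code I)).
Proof. by apply: sub_sigma_algebra; exact: open_cylinder. Qed.

(** Every open set is the union of the cylinders that it contains, and there are
    only countably many words. *)
Lemma borel_code_cylinders (R : realType) (k N : nat) (I : rifs R k N) :
  @measurable _ (borel_code I) = <<s @cylinders R k N I >>.
Proof.
apply/seteqP; split; apply: smallest_sub; try exact: smallest_sigma_algebra.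
  move=> U oU.
  pose F w := if `[< cylinder I w `<=` U >] then cylinder I w else set0.
  have -> : U = \bigcup_w F w.
    apply/seteqP; split => t.
      move=> Ut; have /nbhs_cylinder[n nU] := open_nbhs_nbhs (conj oU Ut).
      exists (code_prefix t n) => //; rewrite /F asboolT//.
      by rewrite cylinderE size_code_prefix.
    by move=> [w _]; rewrite /F; case: asboolP => // wU /wU.
  apply: (@countable_bigcupT_measurable _
    (g_sigma_algebraType (@cylinders R k N I))).
    exact: countableP.
  move=> w; apply: sub_sigma_algebra; rewrite /F; case: asboolP => _.
    by right; exists w.
  by left.
move=> B [->|[w ->]]; first exact: measurable0.
exact: measurable_cylinder.
Qed.

(** The weight of the word [u b] without the stationary weight of its last
    letter: the probability of the transitions alone. *)
Fixpoint transition_weight (R : realType) (k N : nat) (I : rifs R k N)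
    (u : seq 'I_N) (b : 'I_N) : R :=
  if u is a :: u' then rifs_P I (head b u') a * transition_weight I u' b else 1.

Lemma transition_weight_ge0 (R : realType) (k N : nat) (I : rifs R k N)
  (u : seq 'I_N) (b : 'I_N) : 0 <= transition_weight I u b.
Proof. by elim: u => //= a u IH; rewrite mulr_ge0// (rifs_P_stoch I).1. Qed.

Lemma pword_cat (R : realType) (k N : nat) (I : rifs R k N) (p : 'rV[R]_N)
    (u : seq 'I_N) (b : 'I_N) (v : seq 'I_N) :
  pword I p (u ++ b :: v) = transition_weight I u b * pword I p (b :: v).
Proof.
elim: u => [|a u IH]; first by rewrite mul1r.
by rewrite -mulrA -IH; case: u {IH}.
Qed.

(** The Markov property: read from right to left, a code is a path of the chain
    with transition matrix [P]. Given that the letter [b] occurs at a position,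
    the letters before it are independent of those after it, and they form the
    word [u] with probability [transition_weight I u b]. Both sides are finite
    measures in [B], so it is enough to compare them on cylinders, where the
    identity is the factorization [pword_cat] of the weight of a word. *)
Lemma code_measure_shift (R : realType) (k N : nat) (I : rifs R k N)
    (p : 'rV[R]_N) (nu : probability (borel_code I) R)
    (hnu : is_code_measure I p nu) (u : seq 'I_N) (b : 'I_N)
    (B : set (borel_code I)) (mB : measurable B) :
  nu (cylinder I u `&` iter (size u) (@code_shift R k N I) @^-1`
        (cylinder I [:: b] `&` B)) =
  ((transition_weight I u b)%:E * nu (cylinder I [:: b] `&` B))%E.
Proof.
have mcyl := @measurable_cylinder _ _ _ I.
pose s : borel_code I -> borel_code I := iter (size u) (@code_shift R k N I).
have ms : measurable_fun setT s.
  by apply: continuous_borel_measurable; exact: iter_code_shift_continuous.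
pose c : {nonneg R} := NngNum (transition_weight_ge0 I u b).
pose m0 : {measure set (borel_code I) -> \bar R} := mrestr nu (mcyl u).
(* The measure structure of a pushforward depends on the proof [ms], which
   unification cannot find; it is therefore given by name. *)
pose m1 : {measure set (borel_code I) -> \bar R} :=
  measure_function_pushforward__canonical__measure_function_Measure m0 ms.
(* Two measures are compared on all cylinders, not only on those inside the
   cylinder of [b]; hence the restriction to it on both sides. *)
pose m1' : {measure set (borel_code I) -> \bar R} := mrestr m1 (mcyl [:: b]).
pose m2 : {measure set (borel_code I) -> \bar R} :=
  mscale c (mrestr nu (mcyl [:: b])).
have m1E A : m1' A = nu (cylinder I u `&` s @^-1` (cylinder I [:: b] `&` A)).
  rewrite [LHS](_ : _ =
    nu (s @^-1` (A `&` cylinder I [:: b]) `&` cylinder I u))//.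
  by rewrite setIC [A `&` _]setIC.
have m2E A : m2 A =
    ((transition_weight I u b)%:E * nu (cylinder I [:: b] `&` A))%E.
  by rewrite setIC.
rewrite -m1E -m2E.
apply: (@measure_unique _ R (borel_code I) (@cylinders R k N I) (fun=> setT)
  _ _ _ _ m1' m2) => //.
- exact: borel_code_cylinders.
- exact: setI_closed_cylinders.
- by move=> _; right; exists [::]; apply/seteqP; split.
- by rewrite bigcup_const//; exists 0%N.
- move=> A [->|[v ->]]; first by rewrite !measure0.
  rewrite m1E m2E; case: v => [|a v].
    rewrite (_ : cylinder I [::] = setT) ?setIT; last by apply/seteqP; split.
    by rewrite -cylinder_cat !hnu// ?pword_cat//; case: (u).
  rewrite cylinderI//= take0 eqseq_cons andbT; case: eqP => [->|_]; last first.
    by rewrite preimage_set0 setI0 measure0 mule0.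
  by rewrite -cylinder_cat !hnu// ?pword_cat//; case: (u).
- move=> _; rewrite m1E (le_lt_trans (probability_le1 _ _)) ?ltry//.
  apply: measurableI => //; rewrite -[X in measurable X]setTI.
  by apply: (ms) => //; exact: measurableI.
Qed.

(** * Positivity of the stationary vector *)

Lemma mulmx_exp_stationary (R : pzRingType) (N : nat) (P : 'M[R]_N)
  (p : 'rV[R]_N) n : p *m P = p -> p *m (P ^+ n) = p.
Proof.
move=> pP; elim: n => [|n IH]; first by rewrite expr0 mulmx1.
by rewrite exprSr mulmxA IH.
Qed.

(** Some state has positive mass, and by irreducibility some power of [P] moves
    part of that mass to any given state. *)
Lemma stationary_gt0 (R : realType) (k N : nat) (I : rifs R k N)
  (p : 'rV[R]_N) : stationary I p -> forall i, 0 < p ord0 i.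
Proof.
move=> [p0 p1 pP] j.
have [i pi] : exists i, 0 < p ord0 i.
  apply/existsP; apply: contraPT p1 => /existsPn h; rewrite big1 ?(eq_sym 0).
    by apply/eqP; rewrite eq_sym oner_eq0.
  by move=> i _; apply/eqP; rewrite eq_le p0 leNgt h.
have [n _ Pij] := rifs_P_irr I i j.
have Pn0 m l : 0 <= (rifs_P I ^+ m) l j.
  elim: m l => [|m IH] l; first by rewrite expr0 mxE ler0n.
  rewrite exprS mxE sumr_ge0// => h _.
  by rewrite mulr_ge0// (rifs_P_stoch I).1.
rewrite -(mulmx_exp_stationary n pP) mxE (bigD1 i)//=.
rewrite ltr_wpDr ?mulr_gt0// sumr_ge0// => l _.
by rewrite mulr_ge0.
Qed.

Lemma pword_ge0 (R : realType) (k N : nat) (I : rifs R k N) (p : 'rV[R]_N)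
  (w : seq 'I_N) : stationary I p -> 0 <= pword I p w.
Proof.
move=> hp; case/lastP: w => [|u b]; first exact: ler01.
rewrite -cats1 pword_cat mulr_ge0 ?transition_weight_ge0//.
by case: hp => /(_ b).
Qed.

Lemma pmin_gt0 (R : realType) (k N : nat) (I : rifs R k N) (p : 'rV[R]_N) :
  stationary I p -> 0 < pmin p.
Proof. by move=> hp; apply/lt_bigmin => // i _; exact: stationary_gt0 hp i. Qed.

(** The stationary weight of the last letter, the factor that distinguishes the
    two weights, is at least the minimum. *)
Lemma transition_weight_le (R : realType) (k N : nat) (I : rifs R k N)
    (p : 'rV[R]_N) (u : seq 'I_N) (b : 'I_N) : stationary I p ->
  transition_weight I u b <= (pmin p)^-1 * pword I p (rcons u b).
Proof.
move=> hp; rewrite mulrC ler_pdivlMr; last exact: pmin_gt0 hp.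
by rewrite -cats1 pword_cat ler_wpM2l ?transition_weight_ge0//= bigmin_le.
Qed.

(** * The inequality *)

Lemma measure_fin_subadditive (d : measure_display)
    (T : measurableType d) (R : realType)
    (mu : {measure set T -> \bar R}) (J : finType) (P : {pred J})
    (F : J -> set T) (A : set T) :
  measurable A -> (forall j, measurable (F j)) ->
  A `<=` \bigcup_(j in [set` P]) F j ->
  (mu A <= \sum_(j in P) mu (F j))%E.
Proof.
move=> mA mF AF.
have := @content_sub_fsum _ _ _ mu _ [set` P] A F finite_finset
  (fun j _ => mF j) mA AF.
rewrite -(@bigfs _ _ _ J (index_enum J)) ?index_enum_uniq// => j _.
by rewrite mem_index_enum.
Qed.

Theorem lemma2p5 (R : realType) (k N : nat) (I : rifs R k N)
    (E : 'I_N -> set 'rV[R]_k) (hE : is_limit_family I E)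
    (p : 'rV[R]_N) (hp : stationary I p)
    (nu : probability (borel_code I) R) (hnu : is_code_measure I p nu)
    (m : nat) (hm : (2 <= m)%N)
    (A : set (borel_rV R k)) (hA : measurable A) :
  (rifs_measure I E nu A <=
     ((pmin p)^-1)%:E *
     \sum_(w in words I m)
        ((pword I p w)%:E *
         rifs_measure I E nu (rifs_X I `&` fword I w @^-1` A)))%E.
Proof.
have mcyl := @measurable_cylinder _ _ _ I.
have mfA w :
    measurable ([set t | A (fword I w (coding E t))] : set (borel_code I)).
  have := continuous_borel_measurable (@fword_coding_continuous _ _ _ _ _ hE w).
  by move=> /(_ measurableT _ hA); rewrite setTI.
have mA : measurable (coding E @^-1` A : set (borel_code I)).
  exact: (mfA [::]).
rewrite {1}/rifs_measure /pushforward.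
pose F (w : m.-tuple 'I_N) : set (borel_code I) :=
  cylinder I w `&` coding E @^-1` A.
apply: (@le_trans _ _ (\sum_(w in words I m) nu (F w))%E).
  apply: measure_fin_subadditive => //; first by move=> w; exact: measurableI.
  move=> t At.
  have sz : size (code_prefix t m) == m by rewrite size_code_prefix.
  exists (Tuple sz) => /=; last first.
    by split => //; rewrite cylinderE /= size_code_prefix.
  rewrite inE /= code_prefixE; apply/(sortedP (letter t 0)) => i.
  rewrite size_mkseq => im; rewrite !nth_mkseq//; last exact: ltnW.
  exact: letterP.
rewrite ge0_sume_distrr; last first.
  move=> w _; apply: mule_ge0; last exact: (measure_ge0 nu).
  by rewrite lee_fin; exact: pword_ge0.
apply: lee_sum => w _.
have [u [b wE]] : exists u b, w = rcons u b :> seq 'I_N.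
  by case: (lastP w) (size_tuple w) hm => [<- //|u b _ _]; exists u, b.
(* On the cylinder of [w] the coded point is the image under [f_w] of the point
   coded from the last letter of [w] on. *)
have FE : F w = cylinder I u `&` iter (size u) (@code_shift R k N I) @^-1`
    (cylinder I [:: b] `&` [set t | A (fword I w (coding E t))]).
  rewrite preimage_setI setIA -cylinder_cat cats1 -wE.
  apply/seteqP; split => t [tw At]; split => //; move: At; rewrite /preimage/=.
    rewrite (coding_iter_code_shift hE (size u)); move: tw.
    by rewrite cylinderE wE size_rcons => ->.
  rewrite (coding_iter_code_shift hE (size u) t); move: tw.
  by rewrite cylinderE wE size_rcons => ->.
rewrite FE (code_measure_shift hnu)//.
rewrite muleA -EFinM wE.
apply: lee_pmul;
  rewrite ?lee_fin ?transition_weight_ge0 ?measure_ge0 ?transition_weight_le//.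
rewrite -wE /rifs_measure /pushforward.
(* The coded points all lie in [X]. *)
have -> : coding E @^-1` (rifs_X I `&` fword I w @^-1` A) =
    [set t : borel_code I | A (fword I w (coding E t))].
  apply: (@seteqP (borel_code I) _ _).2; split => t; first by case.
  by move=> At; split => //; exact: coding_X.
apply: le_measure; rewrite ?inE//; first exact: measurableI.
Qed.
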